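(* Let $R\in S^2_B(\wedge^2\mathbb{R}^3)$ be an algebraic curvature operator and let $\hat R$ and $\mathring R$ denote the curvature operators of the first and the second kind of $R$, respectively. Then: (1) If $\mathring R$ is two-nonnegative, then $R$ has nonnegative sectional curvature. (2) If $R$ has nonnegative sectional curvature, then $\mathring R$ is $3\frac13$-nonnegative. (3) If $\mathring R$ is $3\frac13$-nonnegative, then $R$ has nonnegative Ricci curvature. (4) If $R$ has nonnegative Ricci curvature, then $\mathring R$ is four-nonnegative. (5) $R$ has nonnegative scalar curvature if and only if $\mathring R$ is five-nonnegative. Moreover, statements (1)-(5) remain true if the word ''nonnegative'' is replaced throughout by ''positive'', or throughout by ''negative'', or throughout by ''nonpositive''.
   Context: $S^2_B(\wedge^2\mathbb{R}^3)$ is the space of algebraic curvature operators on the Euclidean space $\mathbb{R}^3$: tensors $R_{ijkl}$ (components in an orthonormal basis) with $R_{ijkl}=-R_{jikl}=-R_{ijlk}=R_{klij}$ satisfying the first Bianchi identity; the sign convention is that $R_{ijij}$ is the sectional curvature of the plane spanned by $e_i,e_j$; $\mathrm{Ric}_{ik}=\sum_j R_{ijkj}$ and the scalar curvature is the trace of $\mathrm{Ric}$. $\hat R$ acts on two-forms by $\hat R(\omega)_{ij}=\frac12\sum_{k,l}R_{ijkl}\omega_{kl}$. $\overline R$ acts on symmetric two-tensors by $\overline R(\varphi)_{ij}=\sum_{k,l}R_{iklj}\varphi_{kl}$, and the curvature operator of the second kind is $\mathring R=\pi\circ\overline R:S^2_0(\mathbb{R}^3)\to S^2_0(\mathbb{R}^3)$,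 where $S^2_0(\mathbb{R}^3)$ is the 5-dimensional space of traceless symmetric two-tensors and $\pi$ is orthogonal projection onto it. Let $\lambda_1\le\dots\le\lambda_5$ be the eigenvalues of $\mathring R$. For $\alpha\in[1,5]$, $\mathring R$ is $\alpha$-nonnegative (respectively, $\alpha$-positive) if $\lambda_1+\dots+\lambda_{\lfloor\alpha\rfloor}+(\alpha-\lfloor\alpha\rfloor)\lambda_{\lfloor\alpha\rfloor+1}\ge0$ (respectively, $>0$), where the last term is absent if $\alpha$ is an integer. $\mathring R$ is $\alpha$-nonpositive (respectively, $\alpha$-negative) if $-\mathring R$ is $\alpha$-nonnegative (respectively, $\alpha$-positive). *)

(* Defs.v *)
From HB Require Import structures.
From mathcomp Require Import all_boot all_order all_algebra.
From mathcomp Require Import reals ring.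

Set Implicit Arguments.
Unset Strict Implicit.
Unset Printing Implicit Defensive.

Import Order.TTheory GRing.Theory Num.Theory.
Local Open Scope ring_scope.

Section Curvature.
Variable R : realType.

(* Components in the standard orthonormal basis of R^3. *)
Definition tensor4 := 'I_3 -> 'I_3 -> 'I_3 -> 'I_3 -> R.

Definition algebraic_curvature (T : tensor4) : Prop :=
  [/\ forall i j k l, T i j k l = - T j i k l,
      forall i j k l, T i j k l = - T i j l k,
      forall i j k l, T i j k l = T k l i j &
      forall i j k l, T i j k l + T i k l j + T i l j k = 0].

Definition eval4 (T : tensor4) (u v w z : 'rV[R]_3) : R :=
  \sum_i \sum_j \sum_k \sum_l T i j k l * u 0 i * v 0 j * w 0 k * z 0 l.

Definition dot (u v : 'rV[R]_3) : R := \sum_i u 0 i * v 0 i.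

(* Sectional curvature of the plane spanned by [u] and [v], meaningful when
   they are linearly independent; for an orthonormal pair it is R(u,v,u,v). *)
Definition sec (T : tensor4) (u v : 'rV[R]_3) : R :=
  eval4 T u v u v / (dot u u * dot v v - dot u v ^+ 2).

Definition Ric (T : tensor4) : 'M[R]_3 :=
  \matrix_(i, k) \sum_j T i j k j.

Definition scal (T : tensor4) : R := \tr (Ric T).

Definition Rbar (T : tensor4) (phi : 'M[R]_3) : 'M[R]_3 :=
  \matrix_(i, j) \sum_k \sum_l T i k l j * phi k l.

Lemma Rbar_sym (T : tensor4) (phi : 'M[R]_3) :
  algebraic_curvature T -> phi^T = phi -> (Rbar T phi)^T = Rbar T phi.
Proof.
move=> [anti1 anti2 pair _] phiT; apply/matrixP=> i j; rewrite !mxE exchange_big.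
apply: eq_bigr => k _; apply: eq_bigr => l _.
by rewrite -[in LHS]phiT mxE pair anti1 anti2 opprK.
Qed.

Definition asym_part (A : 'M[R]_3) : 'M[R]_3 := A - A^T.
Definition trace_fun (A : 'M[R]_3) : R^o := \tr A.

Lemma asym_part_is_linear : linear asym_part.
Proof.
by move=> a A B; apply/matrixP=> i j; rewrite !mxE mulrBr opprD addrACA.
Qed.
HB.instance Definition _ := GRing.isLinear.Build R 'M[R]_3 'M[R]_3 _
  asym_part asym_part_is_linear.

Lemma trace_fun_is_linear : linear trace_fun.
Proof. by move=> a A B; rewrite /trace_fun linearP. Qed.
HB.instance Definition _ := GRing.isLinear.Build R 'M[R]_3 R^o _
  trace_fun trace_fun_is_linear.

Definition S20 : {vspace 'M[R]_3} :=
  (lker (linfun asym_part) :&: lker (linfun trace_fun))%VS.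

Lemma S20P (A : 'M[R]_3) : reflect (A^T = A /\ \tr A = 0) (A \in S20).
Proof.
rewrite memv_cap !memv_ker !lfunE /= subr_eq0 /trace_fun.
apply: (iffP andP) => [[/eqP AT /eqP ->]|[-> ->]]; by rewrite -?AT ?eqxx.
Qed.

(* Orthogonal projection of all matrices onto [S20]; on a symmetric matrix it
   only removes the trace part. *)
Definition proj_S20 (A : 'M[R]_3) : 'M[R]_3 :=
  2^-1 *: (A + A^T) - (3^-1 * \tr A)%:M.

Lemma proj_S20_sym (A : 'M[R]_3) :
  A^T = A -> proj_S20 A = A - (3^-1 * \tr A)%:M.
Proof.
move=> AT; rewrite /proj_S20 AT -mulr2n -scaler_nat scalerA mulVf ?scale1r //.
by rewrite pnatr_eq0.
Qed.

Lemma proj_S20_in (A : 'M[R]_3) : proj_S20 A \in S20.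
Proof.
apply/S20P; split; rewrite /proj_S20.
  by apply/matrixP=> i j; rewrite !mxE eq_sym [A j i + _]addrC.
rewrite raddfB /= linearZ /= raddfD /= mxtrace_tr mxtrace_scalar -mulr_natl.
by field.
Qed.

Lemma proj_S20_orthogonal (A B : 'M[R]_3) :
  B \in S20 -> \tr ((A - proj_S20 A)^T *m B) = 0.
Proof.
case/S20P=> BT trB.
have trAB : \tr (A *m B) = \tr (A^T *m B).
  by rewrite -mxtrace_tr trmx_mul BT mxtrace_mulC.
have -> : (A - proj_S20 A)^T = A^T - 2^-1 *: (A + A^T) + (3^-1 * \tr A)%:M.
  apply/matrixP=> i j; rewrite !mxE (eq_sym j i).
  by case: (i == j); rewrite ?mulr1n ?mulr0n; ring.
rewrite mulmxDl mulmxBl -scalemxAl mulmxDl mul_scalar_mx.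
rewrite mxtraceD raddfB /= !mxtraceZ mxtraceD trAB trB.
by field.
Qed.

Definition curv2_fun (T : tensor4) (phi : subvs_of S20) : subvs_of S20 :=
  vsproj S20 (proj_S20 (Rbar T (vsval phi))).

Lemma curv2_fun_is_linear T : linear (curv2_fun T).
Proof.
move=> a phi psi; rewrite /curv2_fun -linearP /=; congr (vsproj _ _).
have -> : Rbar T (a *: vsval phi + vsval psi)
        = a *: Rbar T (vsval phi) + Rbar T (vsval psi).
  apply/matrixP=> i j; rewrite !mxE mulr_sumr -big_split; apply: eq_bigr => k _.
  rewrite mulr_sumr -big_split; apply: eq_bigr => l _ /=.
  by rewrite !mxE mulrDr mulrCA.
apply/matrixP=> i j; rewrite /proj_S20 mxtraceD mxtraceZ !mxE.
by case: (i == j); rewrite ?mulr1n ?mulr0n; ring.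
Qed.
HB.instance Definition _ T := GRing.isLinear.Build R (subvs_of S20)
  (subvs_of S20) _ (curv2_fun T) (curv2_fun_is_linear T).

(* Curvature operator of the second kind. *)
Definition curv2 (T : tensor4) : 'End(subvs_of S20) := linfun (curv2_fun T).

Lemma curv2E T phi : vsval (curv2 T phi) = proj_S20 (Rbar T (vsval phi)).
Proof. by rewrite lfunE /= vsprojK // proj_S20_in. Qed.

(* [s] lists the eigenvalues of [f] with multiplicity, in nondecreasing order. *)
Definition ordered_eigenvalues (V : vectType R) (f : 'End(V)) (s : seq R) :=
  sorted <=%R s /\
  char_poly (passmx.mxof (vbasis {:V}) (vbasis {:V}) f) = \prod_(x <- s) ('X - x%:P).

(* For integral [alpha] the last term is zero, even when [s`_m] is the default
   value beyond the end of [s]. *)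
Definition partial_sum (alpha : R) (s : seq R) : R :=
  let m := Num.truncn alpha in \sum_(i < m) s`_i + (alpha - m%:R) * s`_m.

Definition alpha_nonnegative (V : vectType R) alpha (f : 'End(V)) : Prop :=
  exists2 s, ordered_eigenvalues f s & 0 <= partial_sum alpha s.

Definition alpha_positive (V : vectType R) alpha (f : 'End(V)) : Prop :=
  exists2 s, ordered_eigenvalues f s & 0 < partial_sum alpha s.

Inductive curv_sign := Nonnegative | Positive | Negative | Nonpositive.

Definition has_sign (c : curv_sign) (x : R) : Prop :=
  match c with
  | Nonnegative => 0 <= x
  | Positive => 0 < x
  | Negative => x < 0
  | Nonpositive => x <= 0
  end.

Definition alpha_sign (c : curv_sign) (V : vectType R) alpha (f : 'End(V)) : Prop :=
  match c with
  | Nonnegative => alpha_nonnegative alpha f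
  | Positive => alpha_positive alpha f
  | Negative => alpha_positive alpha (- f)
  | Nonpositive => alpha_nonnegative alpha (- f)
  end.

Definition sectional_sign (c : curv_sign) (T : tensor4) : Prop :=
  forall u v : 'rV[R]_3, row_free (col_mx u v) -> has_sign c (sec T u v).

Definition ricci_sign (c : curv_sign) (T : tensor4) : Prop :=
  forall v : 'rV[R]_3, v != 0 -> has_sign c ((v *m Ric T *m v^T) 0 0).

Definition scalar_sign (c : curv_sign) (T : tensor4) : Prop := has_sign c (scal T).

End Curvature.

(* Main.v *)
Require Import Defs.
From HB Require Import structures.
From mathcomp Require Import all_boot all_order all_fingroup all_algebra.
From mathcomp Require Import complex reals ring lra.

Set Implicit Arguments.
Unset Strict Implicit.
Unset Printing Implicit Defensive.

Import Order.TTheory GRing.Theory Num.Theory passmx.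
Local Open Scope ring_scope.

(** In dimension three the curvature tensor is a function of its Ricci tensor
    ([curvature_from_Ricci]), so everything can be read off in an orthonormal
    basis diagonalizing [Ric], whose eigenvalues are written [b + c], [a + c]
    and [a + b] with [a <= b <= c] ([Ricci_frame]).  The numbers [a], [b], [c]
    are then the sectional curvatures of the three coordinate planes.

    In that basis the three classical objects become explicit.  The sectional
    curvature of the plane orthogonal to a unit vector [w] is
    [a w_0^2 + b w_1^2 + c w_2^2] ([eval4_frame]), so its minimum is [a]; the
    minimum of the Ricci curvature is [a + b]; the scalar curvature is
    [2 (a + b + c)].  On a traceless symmetric [phi] the curvature operator of
    the second kind is
      [Ric phi + phi Ric - scal / 2 phi - 2 / 3 tr (Ric phi) I]
    ([Rbar_Ricci], [proj_S20_diagonal]).  It multiplies the three off-diagonal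
    directions by [c], [b] and [a], and on traceless diagonal matrices it is a
    2 by 2 matrix with eigenvalues [(a + b + c) / 3 -+ 2 / 3 r], where
    [r^2 = a^2 + b^2 + c^2 - a b - b c - c a].

    The whole proposition rests on three bounds for [r]:
      [r <= c - a],  [c - (a + b) / 2 <= r],  [(b + c) / 2 - a <= r].
    The last two say that the ordered spectrum is [mu <= a <= b <= c <= nu] with
    [mu], [nu] the two eigenvalues above.  Each implication between signs is
    then linear arithmetic in [a], [b], [c] and [r]: for instance
    [mu + a + b + c / 3 = 4 / 3 (a + b) + 2 / 3 (c - r)] is at least
    [4 / 3 (a + b) + 2 / 3 a] by the first bound and at most [5 / 3 (a + b)] by
    the second.  The negative and nonpositive cases are the positive and
    nonnegative ones for the opposite tensor. *)

(** * Orthogonal diagonalization of real symmetric matrices *)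

(** A real symmetric matrix is hermitian over the complex numbers, so its
    complex spectral decomposition has real diagonal entries; being a root of
    the characteristic polynomial descends to the reals. *)
Lemma symmetric_eigenvalue (R : rcfType) (n : nat) (A : 'M[R]_n.+1) :
  A^T = A -> exists a, eigenvalue A a.
Proof.
move=> AT.
pose AC : 'M[R[i]]_n.+1 := map_mx (real_complex R) A.
have AC_herm : AC \is hermsymmx.
  apply: realsym_hermsym.
    apply/is_hermitianmxP; rewrite expr0 scale1r map_mx_id //.
    by apply/matrixP=> i j; rewrite !mxE -[in LHS]AT mxE.
  by apply/mxOverP=> i j; rewrite mxE complex_real.
have /complex_realP[a dE] := mxOverP (hermitian_spectral_diag_real AC_herm) 0 0.
exists a; rewrite eigenvalue_root_char -(fmorph_root (real_complex R)).
rewrite map_char_poly -eigenvalue_root_char -/AC.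
suff: eigenvalue AC (spectral_diag AC 0 0) by rewrite dE.
have /orthomx_spectralP ACE := hermitian_normalmx AC_herm.
have Pu := spectral_unit AC.
apply/eigenvalueP; exists (row 0 (spectralmx AC)).
  rewrite {2}ACE !mulmxA -row_mul mulmxV // row1 -rowE row_diag_mx.
  by rewrite -scalemxAl -rowE.
apply: contraTneq Pu => P0; rewrite unitmxE.
rewrite (expand_det_row _ 0) big1 ?unitr0 //.
by move=> j _; have /rowP/(_ j) := P0; rewrite !mxE => ->; rewrite mul0r.
Qed.
Lemma row_self_product_gt0 (R : realDomainType) (n : nat) (v : 'rV[R]_n) :
  v != 0 -> 0 < (v *m v^T) 0 0.
Proof.
move=> vN0; rewrite mxE; under eq_bigr do rewrite mxE -expr2.
rewrite lt_def sumr_ge0 ?andbT => [|i _]; last exact: sqr_ge0.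
apply: contra vN0; rewrite psumr_eq0 => [/allP h|i _]; last exact: sqr_ge0.
apply/eqP/rowP=> i; have := h i (mem_index_enum i).
by rewrite /= sqrf_eq0 => /eqP ->; rewrite mxE.
Qed.

(** The Householder reflection exchanging [u] with the first basis vector is an
    orthogonal matrix with first row [u]; if they coincide, the identity is. *)
Lemma orthogonal_with_first_row (R : rcfType) (n : nat) (u : 'rV[R]_n.+1) :
  u *m u^T = 1%:M -> exists2 P : 'M[R]_n.+1, P *m P^T = 1%:M & row 0 P = u.
Proof.
move=> uu.
pose e : 'rV[R]_n.+1 := delta_mx 0 0.
have ee : e *m e^T = 1%:M.
  rewrite /e trmx_delta mul_delta_mx.
  by apply/matrixP=> i j; rewrite !ord1 !mxE.
have [w wE] : {w | w = u - e} by exists (u - e).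
have [w0|wN0] := eqVneq w 0.
  exists 1%:M; first by rewrite trmx1 mulmx1.
  by rewrite row1; move/eqP: w0; rewrite wE subr_eq0 => /eqP.
pose q := (w *m w^T) 0 0.
have wwE : w *m w^T = q%:M by rewrite [LHS]mx11_scalar.
have qN0 : q != 0.
  by rewrite lt0r_neq0 // row_self_product_gt0.
pose P := 1%:M - (2 / q) *: (w^T *m w).
have PT : P^T = P by rewrite /P linearB /= linearZ /= trmx_mul trmxK trmx1.
exists P.
  have XX : (w^T *m w) *m (w^T *m w) = q *: (w^T *m w).
    by rewrite mulmxA -[_ *m w *m w^T]mulmxA wwE mul_mx_scalar -scalemxAl.
  rewrite PT /P mulmxBl mul1mx mulmxBr mulmx1 -!scalemxAl -!scalemxAr XX.
  rewrite -[RHS]addr0 -addrA; congr (_ + _).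
  rewrite !scalerA -scalerBl -opprD -scalerDl.
  by rewrite [X in X *: _](_ : _ = 0) ?scale0r ?oppr0 //; field; exact: qN0.
have ewT : q = - 2 * (e *m w^T) 0 0.
  have ue : u *m e^T = e *m u^T.
    by rewrite [LHS]mx11_scalar -[LHS]tr_scalar_mx -mx11_scalar trmx_mul trmxK.
  have -> : -2 * (e *m w^T) 0 0 = (- 2 *: (e *m w^T)) 0 0 by rewrite [RHS]mxE.
  rewrite /q; congr (fun_of_matrix _ 0 0).
  rewrite scaleNr scaler_nat mulr2n {1}wE mulmxBl opprD; congr (_ + _).
  by rewrite wE [(u - e)^T]linearB /= !mulmxBr uu ee ue opprB.
rewrite rowE -/e /P mulmxBr mulmx1 -scalemxAr mulmxA.
rewrite [e *m w^T]mx11_scalar mul_scalar_mx scalerA.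
have -> : 2 / q * (e *m w^T) 0 0 = -1.
  have -> : (e *m w^T) 0 0 = - (q / 2) by rewrite {1}ewT; field.
  by field.
by rewrite scaleN1r opprK wE addrC subrK.
Qed.

(** Moving a unit eigenvector to the first basis vector by an orthogonal matrix
    makes the first row, hence by symmetry the first column, vanish off the
    diagonal; the induction continues on the remaining diagonal block. *)
Theorem symmetric_orthogonally_diagonalizable (R : rcfType) (n : nat)
    (A : 'M[R]_n) :
  A^T = A ->
  exists P : 'M[R]_n, exists2 d : 'rV[R]_n,
    P *m P^T = 1%:M & P *m A *m P^T = diag_mx d.
Proof.
elim: n A => [|n IHn] A AT.
  by exists 1%:M, 0; apply/matrixP=> [[]].
have [a /eigenvalueP[v vA vN0]] := symmetric_eigenvalue AT.
have vv : 0 < (v *m v^T) 0 0.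
  exact: row_self_product_gt0 vN0.
pose u := (Num.sqrt ((v *m v^T) 0 0))^-1 *: v.
have uu : u *m u^T = 1%:M.
  apply/matrixP=> i j.
  rewrite !ord1 /u linearZ /= -scalemxAl -scalemxAr scalerA.
  rewrite mxE -invfM -expr2 sqr_sqrtr ?ltW // mulVf ?lt0r_neq0 //.
  by rewrite [RHS]mxE.
have uA : u *m A = a *: u by rewrite -scalemxAl vA !scalerA mulrC.
have [P PP Pu] := orthogonal_with_first_row uu.
pose B : 'M_(1 + n) := P *m A *m P^T.
have BT : B^T = B by rewrite /B !trmx_mul trmxK AT mulmxA.
have B0 : row 0 B = a *: delta_mx 0 0.
  by rewrite /B !row_mul Pu uA -scalemxAl -Pu -row_mul PP row1.
have Bur : ursubmx B = 0.
  apply/matrixP=> i j; have /rowP/(_ (rshift 1 j)) := B0.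
  by rewrite !mxE ord1 !lshift0 mulr0.
have Bdl : dlsubmx B = 0 by rewrite -BT -trmx_ursub Bur trmx0.
have Bul : ulsubmx B = a%:M.
  apply/matrixP=> i j; have /rowP/(_ (lshift n j)) := B0.
  by rewrite !mxE !ord1 !lshift0 /= mulr1 mulr1n.
have CT : (drsubmx B)^T = drsubmx B by rewrite trmx_drsub BT.
have [Q [d QQ QC]] := IHn _ CT.
pose Q1 : 'M_(1 + n) := block_mx 1%:M 0 0 Q.
have QQ1 : Q1 *m Q1^T = 1%:M.
  rewrite tr_block_mx mulmx_block !trmx0 trmx1 !mulmx0 !mul0mx mulmx1 QQ.
  by rewrite !addr0 add0r -scalar_mx_block.
have QB : Q1 *m B *m Q1^T = diag_mx (row_mx a%:M d).
  rewrite -[B]submxK Bur Bdl Bul tr_block_mx !mulmx_block !trmx0 trmx1.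
  rewrite !(mulmx0, mul0mx, mulmx1, mul1mx, addr0, add0r) QC diag_mx_row.
  by congr block_mx; apply/matrixP=> i j; rewrite !ord1 !mxE.
exists (Q1 *m P), (row_mx a%:M d).
  by rewrite trmx_mul mulmxA -[_ *m P *m _]mulmxA PP mulmx1.
by rewrite trmx_mul !mulmxA -2!(mulmxA Q1).
Qed.

Lemma permutation_sorting_row (R : realDomainType) (n : nat) (d : 'rV[R]_n) :
  exists s : 'S_n, forall i j : 'I_n, (i <= j)%N -> d 0 (s j) <= d 0 (s i).
Proof.
pose t := [tuple d 0 i | i < n].
have : perm_eq (sort_tuple >=%R t) t by rewrite perm_sort.
case/tuple_permP=> s sE; exists s => i j leij.
have nthE (k : 'I_n) : nth 0 (sort >=%R t) k = d 0 (s k).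
  by rewrite sE (nth_map k) ?size_enum_ord // nth_ord_enum tnth_mktuple.
rewrite -!nthE; have srt : sorted >=%R (sort >=%R t).
  by apply: sort_sorted => x y; exact: le_total.
apply: (sorted_leq_nth _ _ 0 srt) => //; rewrite ?inE ?size_sort ?size_tuple //.
- by move=> x y z yx zx; exact: le_trans zx yx.
- by move=> x; exact: lexx.
Qed.

Corollary symmetric_sorted_diagonalization (R : rcfType) (n : nat)
    (A : 'M[R]_n) :
  A^T = A ->
  exists P : 'M[R]_n, exists d : 'rV[R]_n,
    [/\ P *m P^T = 1%:M, P *m A *m P^T = diag_mx d &
        forall i j : 'I_n, (i <= j)%N -> d 0 j <= d 0 i].
Proof.
case/symmetric_orthogonally_diagonalizable=> P [d PP PAP].
have [s ds] := permutation_sorting_row d.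
exists (row_perm s P), (\row_i d 0 (s i)); split.
- rewrite row_permE trmx_mul mulmxA -[_ *m P *m _]mulmxA PP mulmx1.
  by rewrite tr_perm_mx -perm_mxM mulgV perm_mx1.
- rewrite row_permE trmx_mul !mulmxA -2!(mulmxA (perm_mx s)) PAP.
  rewrite tr_perm_mx -row_permE -col_permE; apply/matrixP=> i j.
  by rewrite !mxE (inj_eq perm_inj).
- by move=> i j leij; rewrite !mxE ds.
Qed.

(** * Characteristic polynomials of endomorphisms *)

(** A row-free and row-full [G] is square and invertible. Leaving its shape
    rectangular lets [m] and [n] be expressions that are only provably equal,
    such as a numeral and the dimension of a vector space. *)
Lemma char_poly_intertwine (F : fieldType) (m n : nat) (A : 'M[F]_m)
    (B : 'M[F]_n) (G : 'M[F]_(m, n)) :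
  row_free G -> row_full G -> A *m G = G *m B -> char_poly A = char_poly B.
Proof.
move=> /eqP rm /eqP rn; have mn : m = n by rewrite -rm rn.
subst n => AG; have Gu : G \in unitmx by rewrite -row_free_unit /row_free rm.
have detG : \det (map_mx polyC G) != 0.
  by rewrite det_map_mx polyC_eq0 -unitfE -unitmxE.
apply: (mulIf detG); rewrite /char_poly -det_mulmx [RHS]mulrC -det_mulmx.
congr (\det _); rewrite /char_poly_mx mulmxBl mulmxBr.
by rewrite -!map_mxM AG scalar_mxC.
Qed.

(** Any linear parametrization of [V] may replace the canonical basis when
    computing the characteristic polynomial of an endomorphism, without first
    knowing the dimension of [V]. *)
Lemma char_poly_mxof (F : fieldType) (V : vectType F) (f : 'End(V)) (n : nat)
    (M : 'M[F]_n) (h : {linear 'rV[F]_n -> V}) :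
  injective h -> (forall x, exists v, h v = x) ->
  (forall v, f (h v) = h (v *m M)) ->
  char_poly (mxof (vbasis {:V}) (vbasis {:V}) f) = char_poly M.
Proof.
move=> h_inj h_surj fh.
have eb : basis_of {:V} (vbasis {:V}) := vbasisP _.
pose G := lin1_mx (rVof (vbasis {:V}) \o h).
have vG (v : 'rV_n) : v *m G = rVof (vbasis {:V}) (h v).
  by rewrite mul_rV_lin1.
apply/esym/(@char_poly_intertwine _ _ _ _ _ G).
- apply: inj_row_free => v; rewrite vG => /eqP; rewrite rVof_eq0 //.
  by move=> /eqP hv0; apply: h_inj; rewrite hv0 linear0.
- rewrite -sub1mx; apply/rV_subP=> w _.
  have [v hv] := h_surj (vecof (vbasis {:V}) w).
  by apply/submxP; exists v; rewrite vG hv vecofK.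
- apply/row_matrixP=> i; rewrite !row_mul !rowE.
  rewrite -[delta_mx 0 i *m M *m G]/(_ *m G).
  by rewrite !vG -rVof_app // fh.
Qed.

(** * Curvature in dimension three *)

Lemma ord3_cases (P : 'I_3 -> Prop) :
  P 0 -> P 1 -> P 2%:R -> forall i, P i.
Proof.
move=> P0 P1 P2 [[|[|[|i]]] lt_i3] //.
- by rewrite (_ : Ordinal _ = 0) //; apply: val_inj.
- by rewrite (_ : Ordinal _ = 1) //; apply: val_inj.
- by rewrite (_ : Ordinal _ = 2%:R) //; apply: val_inj.
Qed.

Lemma sum3 (V : nmodType) (F : 'I_3 -> V) : \sum_i F i = F 0 + F 1 + F 2%:R.
Proof.
rewrite !big_ord_recl big_ord0 addr0 addrA.
by congr (F _ + F _ + F _); apply: val_inj.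
Qed.

(** The Weyl tensor vanishes in dimension three.  Up to the symmetries there are
    six independent components of [T], and six of [Ric T]; the identity is the
    inversion of this linear system. *)
Lemma curvature_from_Ricci (R : realType) (T : tensor4 R) :
  algebraic_curvature T -> forall i j k l,
  T i j k l = Ric T i k *+ (j == l) + Ric T j l *+ (i == k)
            - Ric T i l *+ (j == k) - Ric T j k *+ (i == l)
            - scal T / 2 * (((i == k) && (j == l))%:R
                           - ((i == l) && (j == k))%:R).
Proof.
case=> anti1 anti2 pair _.
(* Orienting every index pair and the exchange of pairs leaves the six
   components 0101, 0102, 0112, 0202, 0212 and 1212. *)
have diag1 i k l : T i i k l = 0.
  have := anti1 i i k l; lra.
have diag2 i j k : T i j k k = 0.
  have := anti2 i j k k; lra.
pose o0 : 'I_3 := 0; pose o1 : 'I_3 := 1; pose o2 : 'I_3 := 2%:R.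
have ricE i k : Ric T i k = T i o0 k o0 + T i o1 k o1 + T i o2 k o2.
  by rewrite mxE sum3.
have scalE : scal T = 2 * (T o0 o1 o0 o1 + T o0 o2 o0 o2 + T o1 o2 o1 o2).
  rewrite /scal /mxtrace sum3 !ricE -/o0 -/o1 -/o2 !diag1.
  rewrite (anti1 o1 o0) (anti2 o0 o1 o1) (anti1 o2 o0) (anti2 o0 o2 o2).
  by rewrite (anti1 o2 o1) (anti2 o1 o2 o2); ring.
move=> i j k l; rewrite scalE !ricE.
elim/ord3_cases: i; elim/ord3_cases: j; elim/ord3_cases: k; elim/ord3_cases: l;
  rewrite -/o0 -/o1 -/o2 ?diag1 ?diag2 /=
  ?(anti1 o1 o0) ?(anti1 o2 o0) ?(anti1 o2 o1)
  ?(anti2 _ _ o1 o0) ?(anti2 _ _ o2 o0) ?(anti2 _ _ o2 o1) ?diag1 ?diag2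
  ?(pair o0 o2 o0 o1) ?(pair o1 o2 o0 o1) ?(pair o1 o2 o0 o2); by field.
Qed.

Lemma Ric_sym (R : realType) (T : tensor4 R) :
  algebraic_curvature T -> (Ric T)^T = Ric T.
Proof.
case=> _ _ pair _; apply/matrixP=> i k; rewrite !mxE.
by apply: eq_bigr => j _; exact: pair.
Qed.

Lemma Rbar_Ricci (R : realType) (T : tensor4 R) (phi : 'M[R]_3) :
  algebraic_curvature T -> phi \in S20 R ->
  Rbar T phi = Ric T *m phi + phi *m Ric T - (scal T / 2) *: phi
             - (\tr (Ric T *m phi))%:M.
Proof.
move=> hT /S20P[phiT].
have ricS i j : Ric T j i = Ric T i j 
  by have /matrixP/(_ i j) := Ric_sym hT; rewrite mxE.
have phiS i j : phi j i = phi i j by rewrite -[in RHS]phiT mxE.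
rewrite {1}/mxtrace sum3 => trphi.
have {trphi} phi22 : phi 2%:R 2%:R = - (phi 0 0 + phi 1 1) by lra.
apply/matrixP=> i j; rewrite mxE.
under eq_bigr do under eq_bigr do rewrite curvature_from_Ricci //.
move: (scal T) (Ric T) ricS => s ric ricS.
rewrite !sum3 !mxE !sum3 /mxtrace !sum3 !mxE !sum3.
elim/ord3_cases: i; elim/ord3_cases: j; rewrite /=
  ?(phiS 0 1) ?(phiS 0 2%:R) ?(phiS 1 2%:R) ?phi22
  ?(ricS 0 1) ?(ricS 0 2%:R) ?(ricS 1 2%:R); by field.
Qed.

(** * The curvature operator of the second kind in a Ricci eigenbasis *)

Lemma char_poly_mx22 (R : comNzRingType) (A : 'M[R]_2) :
  char_poly A = ('X - (A 0 0)%:P) * ('X - (A 1 1)%:P) - (A 0 1 * A 1 0)%:P.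
Proof.
have lift01 : lift 0 0 = 1 :> 'I_2 by apply: val_inj.
have lift10 : lift 1 0 = 0 :> 'I_2 by apply: val_inj.
rewrite /char_poly (expand_det_row _ 0) !big_ord_recl big_ord0 addr0 lift01.
rewrite /cofactor !det_mx11 !mxE /= lift01 lift10 !mulr1n !mulr0n polyCM.
by rewrite !expr0 !expr1; ring.
Qed.

(** Coordinates on traceless symmetric matrices, the off-diagonal entries
    first, so that the operator of a diagonal Ricci tensor is block diagonal.
    *)
Definition traceless_sym (R : realType) (v : 'rV[R]_(3 + 2)) : 'M[R]_3 :=
  let o := lsubmx v 0 in let x := rsubmx v 0 0 in let y := rsubmx v 0 1 in
  \matrix_(i, j)
    nth 0 (nth [::] [:: [:: x;    o 0;    o 1];
                        [:: o 0;  y;      o 2%:R];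
                        [:: o 1;  o 2%:R; - (x + y)]] i) j.

Definition framed_traceless_sym (R : realType) (P : 'M[R]_3)
    (v : 'rV[R]_(3 + 2)) : subvs_of (S20 R) :=
  vsproj (S20 R) (P^T *m traceless_sym v *m P).

Lemma framed_traceless_sym_is_linear (R : realType) (P : 'M[R]_3) :
  linear (framed_traceless_sym P).
Proof.
move=> a u v; rewrite /framed_traceless_sym.
suff -> : traceless_sym (a *: u + v) = a *: traceless_sym u + traceless_sym v.
  by rewrite mulmxDr mulmxDl -scalemxAr -scalemxAl linearP.
apply/matrixP=> i j; elim/ord3_cases: i; elim/ord3_cases: j;
  rewrite !mxE /= ?mxE; ring.
Qed.
HB.instance Definition _ (R : realType) (P : 'M[R]_3) :=
  GRing.isLinear.Build R 'rV[R]_(3 + 2) (subvs_of (S20 R)) _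
    (framed_traceless_sym P) (framed_traceless_sym_is_linear P).

Lemma traceless_sym_tr (R : realType) (v : 'rV[R]_(3 + 2)) :
  (traceless_sym v)^T = traceless_sym v.
Proof.
by apply/matrixP=> i j; elim/ord3_cases: i; elim/ord3_cases: j; rewrite !mxE.
Qed.

Lemma traceless_sym_trace (R : realType) (v : 'rV[R]_(3 + 2)) :
  \tr (traceless_sym v) = 0.
Proof. by rewrite /mxtrace sum3 !mxE /=; ring. Qed.

Section Frame.
Variables (R : realType) (P : 'M[R]_3).
Hypothesis PP : P *m P^T = 1%:M.

Lemma val_framed_traceless_sym v :
  vsval (framed_traceless_sym P v) = P^T *m traceless_sym v *m P.
Proof.
rewrite /framed_traceless_sym vsprojK //; apply/S20P; split.
  rewrite !trmx_mul trmxK mulmxA; congr (_ *m _ *m _).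
  exact: traceless_sym_tr.
by rewrite mxtrace_mulC mulmxA PP mul1mx traceless_sym_trace.
Qed.

Lemma framed_traceless_sym_inj : injective (framed_traceless_sym P).
Proof.
apply: raddf_inj => v hv0.
have PhP : traceless_sym v = P *m vsval (framed_traceless_sym P v) *m P^T.
  rewrite val_framed_traceless_sym !mulmxA PP mul1mx -mulmxA PP mulmx1 //.
have v0 i j : traceless_sym v i j = 0.
  by rewrite PhP hv0 [vsval 0]linear0 mulmx0 mul0mx mxE.
rewrite -[v]hsubmxK; have -> : lsubmx v = 0.
  apply/rowP; elim/ord3_cases; rewrite [RHS]mxE.
  - by have := v0 0 1; rewrite mxE.
  - by have := v0 0 2%:R; rewrite mxE.
  - by have := v0 1 2%:R; rewrite mxE.
suff -> : rsubmx v = 0 by rewrite row_mx0.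
apply/rowP=> -[[|[|i]] lti2] //; rewrite [RHS]mxE.
- by have := v0 0 0; rewrite mxE /= => <-; congr (rsubmx v 0 _); apply: val_inj.
- by have := v0 1 1; rewrite mxE /= => <-; congr (rsubmx v 0 _); apply: val_inj.
Qed.

Lemma framed_traceless_sym_surj (phi : subvs_of (S20 R)) :
  exists v, framed_traceless_sym P v = phi.
Proof.
pose psi := P *m vsval phi *m P^T.
have /S20P[phiT trphi] := subvsP phi.
have psiT i j : psi j i = psi i j.
  suff psiT : psi^T = psi by rewrite -[in LHS]psiT mxE.
  by rewrite /psi !trmx_mul trmxK phiT mulmxA.
have : \tr psi = 0 by rewrite mxtrace_mulC mulmxA (mulmx1C PP) mul1mx.
rewrite {1}/mxtrace sum3 => trpsi.
have phiE : vsval phi = P^T *m psi *m P.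
  by rewrite /psi !mulmxA (mulmx1C PP) mul1mx -mulmxA (mulmx1C PP) mulmx1.
move: psi psiT trpsi phiE => psi psiT trpsi phiE.
exists (row_mx (\row_i [:: psi 0 1; psi 0 2%:R; psi 1 2%:R]`_i)
               (\row_i [:: psi 0 0; psi 1 1]`_i)).
apply: val_inj; rewrite /= val_framed_traceless_sym phiE.
congr (_ *m _ *m _); apply/matrixP=> i j; rewrite mxE row_mxKl row_mxKr.
elim/ord3_cases: i; elim/ord3_cases: j; rewrite !mxE //=.
by apply/eqP; rewrite eq_sym -subr_eq0 opprK addrC trpsi.
Qed.
End Frame.

Lemma proj_S20_conj (R : realType) (P Y : 'M[R]_3) :
  P *m P^T = 1%:M -> proj_S20 (P^T *m Y *m P) = P^T *m proj_S20 Y *m P.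
Proof.
move=> PP; rewrite /proj_S20 mulmxBr mulmxBl -scalemxAr -scalemxAl.
rewrite mulmxDr mulmxDl mul_mx_scalar -scalemxAl (mulmx1C PP) scalemx1.
by rewrite [\tr (_ *m P)]mxtrace_mulC mulmxA PP mul1mx !trmx_mul trmxK !mulmxA.
Qed.

(** For a diagonal Ricci tensor the operator acts on each off-diagonal entry
    by a scalar and only couples the diagonal entries, through the trace term.
    *)
Lemma proj_S20_diagonal (R : realType) (d : 'rV[R]_3) (s : R) (psi : 'M[R]_3) :
  psi^T = psi -> \tr psi = 0 ->
  proj_S20 (diag_mx d *m psi + psi *m diag_mx d - s *: psi
            - (\tr (diag_mx d *m psi))%:M)
  = \matrix_(i, j) ((d 0 i + d 0 j - s) * psi i j
                    - 2 / 3 * (\sum_k d 0 k * psi k k) *+ (i == j)).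
Proof.
move=> psiT trpsi; set t := \tr (diag_mx d *m psi).
have tE : t = \sum_k d 0 k * psi k k.
  by apply: eq_bigr => k _; rewrite mul_diag_mx mxE.
rewrite proj_S20_sym.
  rewrite !raddfB /= raddfD /= [\tr (psi *m _)]mxtrace_mulC -/t mxtraceZ trpsi.
  rewrite mxtrace_scalar -tE mul_diag_mx mul_mx_diag.
  by apply/matrixP=> i j; rewrite !mxE; case: (i == j); field.
rewrite !linearB linearD /= linearZ /= !trmx_mul tr_diag_mx psiT tr_scalar_mx.
by rewrite [_ *m psi + _]addrC.
Qed.

Definition ricci_row (R : realType) (a b c : R) : 'rV[R]_3 :=
  \row_i [:: b + c; a + c; a + b]`_i.

(** The matrix, acting on rows, of the curvature operator of the second kind
    in the coordinates of [traceless_sym], for Ricci eigenvalues [ricci_row a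
    b c]. *)
Definition curv2_block (R : realType) (a b c : R) : 'M[R]_(3 + 2) :=
  block_mx (diag_mx (\row_i [:: c; b; a]`_i)) 0 0
    (\matrix_(i, j)
       nth 0 (nth [::] [:: [:: b + (c - a) / 3;    - (2 / 3 * (c - a))];
                           [:: - (2 / 3 * (c - b)); a + (c - b) / 3]] i) j).

Lemma curv2_framed (R : realType) (T : tensor4 R) (P : 'M[R]_3) (a b c : R) v :
  algebraic_curvature T -> P *m P^T = 1%:M ->
  P *m Ric T *m P^T = diag_mx (ricci_row a b c) ->
  curv2 T (framed_traceless_sym P v)
  = framed_traceless_sym P (v *m curv2_block a b c).
Proof.
move=> hT PP RicD; apply: val_inj; rewrite /= curv2E Rbar_Ricci ?subvsP //.
have RicE : Ric T = P^T *m diag_mx (ricci_row a b c) *m P.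
  by rewrite -RicD !mulmxA (mulmx1C PP) mul1mx -mulmxA (mulmx1C PP) mulmx1.
have scalE : scal T = 2 * (a + b + c).
  rewrite /scal RicE mxtrace_mulC mulmxA PP mul1mx mxtrace_diag sum3 !mxE /=.
  by ring.
rewrite scalE !val_framed_traceless_sym // {scalE} RicE.
set D := diag_mx _; set psi := traceless_sym v.
(* The operator commutes with conjugation by [P], which is then factored out. *)
have conjM X Y : P^T *m X *m P *m (P^T *m Y *m P) = P^T *m (X *m Y) *m P.
  by rewrite !mulmxA -[_ *m P *m P^T]mulmxA PP mulmx1.
have trM X : \tr (P^T *m X *m P) = \tr X.
  by rewrite mxtrace_mulC mulmxA PP mul1mx.
rewrite !conjM trM.
have -> : (\tr (D *m psi))%:M = P^T *m (\tr (D *m psi))%:M *m P.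
  by rewrite mul_mx_scalar -scalemxAl (mulmx1C PP) scalemx1.
rewrite [_ *: (_ *m P)]scalemxAl [_ *: (_ *m psi)]scalemxAr.
rewrite -mulmxDl -mulmxDr -mulmxBl -mulmxBr -mulmxBl -mulmxBr.
rewrite proj_S20_conj //; congr (_ *m _ *m _).
have -> : v *m curv2_block a b c =
    row_mx (lsubmx v *m ulsubmx (curv2_block a b c))
           (rsubmx v *m drsubmx (curv2_block a b c)).
  rewrite -[v in LHS]hsubmxK mul_row_block block_mxKul block_mxKdr.
  by rewrite !mulmx0 addr0 add0r.
rewrite /D proj_S20_diagonal ?traceless_sym_tr ?traceless_sym_trace //.
rewrite /psi /traceless_sym row_mxKl row_mxKr.
rewrite block_mxKul block_mxKdr mul_mx_diag.
have lift01 : lift 0 0 = 1 :> 'I_2 by apply: val_inj.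
apply/matrixP=> i j; rewrite [LHS]mxE [RHS]mxE sum3.
by elim/ord3_cases: i; elim/ord3_cases: j;
  rewrite !mxE /= ?mxE /= ?big_ord_recl ?big_ord0 ?lift01 ?mxE /=; field.
Qed.

(** * Sectional, Ricci and scalar curvature in a Ricci eigenbasis *)

Lemma dotE (R : realType) (u v : 'rV[R]_3) : dot u v = (u *m v^T) 0 0.
Proof. by rewrite mxE; apply: eq_bigr => i _; rewrite mxE. Qed.

Lemma eval4_Ricci (R : realType) (T : tensor4 R) (u v : 'rV[R]_3) :
  algebraic_curvature T ->
  eval4 T u v u v =
    (u *m Ric T *m u^T) 0 0 * dot v v + (v *m Ric T *m v^T) 0 0 * dot u u
    - ((u *m Ric T *m v^T) 0 0 + (v *m Ric T *m u^T) 0 0) * dot u v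
    - scal T / 2 * (dot u u * dot v v - dot u v ^+ 2).
Proof.
move=> hT; rewrite /eval4.
under eq_bigr do under eq_bigr do under eq_bigr do under eq_bigr do
  rewrite curvature_from_Ricci //.
move: (scal T / 2) (Ric T) => s ric.
rewrite /dot !sum3 !mxE !sum3 !mxE !sum3 /= !mulr1n !mulr0n.
by ring.
Qed.

(** Setting [a], [b], [c] to half the scalar curvature minus each Ricci
    eigenvalue makes the eigenvalues [b + c], [a + c], [a + b]; decreasing
    Ricci eigenvalues give increasing [a], [b], [c]. *)
Lemma Ricci_frame (R : realType) (T : tensor4 R) :
  algebraic_curvature T ->
  exists P : 'M[R]_3, exists a b c : R,
    [/\ P *m P^T = 1%:M, P *m Ric T *m P^T = diag_mx (ricci_row a b c),
        a <= b & b <= c].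
Proof.
move=> hT.
have [P [d [PP RicD dS]]] := symmetric_sorted_diagonalization (Ric_sym hT).
exists P; pose s := (d 0 0 + d 0 1 + d 0 2%:R) / 2.
exists (s - d 0 0), (s - d 0 1), (s - d 0 2%:R); split=> //.
- rewrite RicD; congr diag_mx; apply/rowP; elim/ord3_cases; rewrite [RHS]mxE /=;
    by rewrite /s; field.
- by rewrite lerD2l lerN2 dS.
- by rewrite lerD2l lerN2 dS.
Qed.

(** The Gram determinant times [dot u u] is the squared length of a nontrivial
    combination of [u] and [v]. *)
Lemma gram_gt0 (R : realType) (u v : 'rV[R]_3) :
  row_free (col_mx u v) -> 0 < dot u u * dot v v - dot u v ^+ 2.
Proof.
move=> uv_free.
have no_rel p q : p *: u + q *: v = 0 -> p = 0 /\ q = 0.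
  move=> puqv; have : row_mx p%:M q%:M *m col_mx u v = 0.
    by rewrite mul_row_col !mul_scalar_mx.
  move/eqP; rewrite mulmx_free_eq0 // -row_mx0 => /eqP/eq_row_mx[].
  by move=> /matrixP/(_ 0 0) + /matrixP/(_ 0 0); rewrite !mxE !mulr1n.
have uN0 : u != 0.
  apply/eqP=> u0; have [] := no_rel 1 0; last by move/eqP; rewrite oner_eq0.
  by rewrite u0 scaler0 scale0r addr0.
have uu : 0 < dot u u by rewrite dotE row_self_product_gt0.
pose z := - dot u v *: u + dot u u *: v.
have zN0 : z != 0.
  by apply/eqP=> /no_rel[_ uu0]; rewrite uu0 ltxx in uu.
have : 0 < dot z z by rewrite dotE row_self_product_gt0.
have -> : dot z z = dot u u * (dot u u * dot v v - dot u v ^+ 2).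
  have dotD p q : dot (- p *: u + q *: v) (- p *: u + q *: v)
      = p ^+ 2 * dot u u - 2 * p * q * dot u v + q ^+ 2 * dot v v.
    by rewrite /dot !sum3 !mxE; ring.
  by rewrite /z dotD; ring.
by rewrite pmulr_rgt0.
Qed.

Lemma Lagrange_identity (R : realType) (x y : 'rV[R]_3) :
  dot x x * dot y y - dot x y ^+ 2 =
      (x 0 1 * y 0 2%:R - x 0 2%:R * y 0 1) ^+ 2
    + (x 0 2%:R * y 0 0 - x 0 0 * y 0 2%:R) ^+ 2
    + (x 0 0 * y 0 1 - x 0 1 * y 0 0) ^+ 2.
Proof. by rewrite /dot !sum3; ring. Qed.

Section Frame.
Variables (R : realType) (T : tensor4 R) (P : 'M[R]_3) (a b c : R).
Hypothesis hT : algebraic_curvature T.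
Hypothesis PP : P *m P^T = 1%:M.
Hypothesis RicD : P *m Ric T *m P^T = diag_mx (ricci_row a b c).
Hypotheses (le_ab : a <= b) (le_bc : b <= c).

Lemma scal_frame : scal T = 2 * (a + b + c).
Proof.
have -> : scal T = \tr (P *m Ric T *m P^T).
  by rewrite mxtrace_mulC mulmxA (mulmx1C PP) mul1mx.
by rewrite RicD mxtrace_diag sum3 !mxE /=; ring.
Qed.

Lemma Ric_form_frame (u v : 'rV[R]_3) :
  let x := u *m P^T in let y := v *m P^T in
  (u *m Ric T *m v^T) 0 0 =
    (b + c) * (x 0 0 * y 0 0) + (a + c) * (x 0 1 * y 0 1)
    + (a + b) * (x 0 2%:R * y 0 2%:R).
Proof.
move=> x y.
have -> : u *m Ric T *m v^T = x *m diag_mx (ricci_row a b c) *m y^T.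
  rewrite -RicD /x /y trmx_mul trmxK !mulmxA -[u *m P^T *m P]mulmxA.
  rewrite (mulmx1C PP) mulmx1 -[_ *m P^T *m P]mulmxA (mulmx1C PP) mulmx1 //.
rewrite mul_mx_diag; clearbody x y; rewrite mxE sum3 !mxE /=.
by congr (_ + _ + _); rewrite -mulrA mulrCA.
Qed.

Lemma dot_frame (u v : 'rV[R]_3) : dot (u *m P^T) (v *m P^T) = dot u v.
Proof.
rewrite !dotE trmx_mul trmxK mulmxA.
by rewrite -[u *m P^T *m P]mulmxA (mulmx1C PP) mulmx1.
Qed.

(** In the frame, the numerator of the sectional curvature is the quadratic form
    with eigenvalues [a], [b], [c] at the cross product of [u] and [v]; its
    denominator is the squared length of that cross product, by
    [Lagrange_identity]. *)
Lemma eval4_frame (u v : 'rV[R]_3) :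
  let x := u *m P^T in let y := v *m P^T in
  eval4 T u v u v =
      a * (x 0 1 * y 0 2%:R - x 0 2%:R * y 0 1) ^+ 2
    + b * (x 0 2%:R * y 0 0 - x 0 0 * y 0 2%:R) ^+ 2
    + c * (x 0 0 * y 0 1 - x 0 1 * y 0 0) ^+ 2.
Proof.
move=> x y; rewrite eval4_Ricci // scal_frame !Ric_form_frame -/x -/y.
rewrite -(dot_frame u u) -(dot_frame v v) -(dot_frame u v) -/x -/y.
by clearbody x y; rewrite /dot !sum3; field.
Qed.

Lemma le_sec u v : row_free (col_mx u v) -> a <= sec T u v.
Proof.
move=> /gram_gt0 guv; rewrite /sec ler_pdivlMr // eval4_frame.
rewrite -(dot_frame u u) -(dot_frame v v) -(dot_frame u v).
move: (u *m P^T) (v *m P^T) => x y; rewrite Lagrange_identity.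
move: (x 0 1 * _ - _) (x 0 2%:R * _ - _) (x 0 0 * _ - _) => w0 w1 w2.
have := sqr_ge0 w0; have := sqr_ge0 w1; have := sqr_ge0 w2.
by move: le_ab le_bc; nra.
Qed.

Lemma frame_row (i : 'I_3) : row i P *m P^T = delta_mx 0 i.
Proof. by rewrite -row_mul PP row1. Qed.

Lemma sec_min : exists u v, row_free (col_mx u v) /\ sec T u v = a.
Proof.
exists (row 1 P), (row 2%:R P); split.
  apply/row_freeP; exists (P^T *m row_mx (delta_mx 1 0) (delta_mx 2%:R 0)).
  rewrite mulmxA mul_col_mx !frame_row mul_col_row !mul_delta_mx_cond /=.
  rewrite !mulr0n !mulr1n [RHS]scalar_mx_block.
  by congr block_mx; apply/matrixP=> i j; rewrite !ord1 !mxE.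
rewrite /sec eval4_frame -!(dot_frame (row _ P)) !frame_row /dot !sum3 !mxE /=.
by field.
Qed.

Lemma le_Ric (v : 'rV[R]_3) :
  (a + b) * dot v v <= (v *m Ric T *m v^T) 0 0.
Proof.
rewrite Ric_form_frame -(dot_frame v v); move: (v *m P^T) => x.
rewrite /dot sum3.
have := sqr_ge0 (x 0 0); have := sqr_ge0 (x 0 1); have := sqr_ge0 (x 0 2%:R).
by move: le_ab le_bc; nra.
Qed.

Lemma Ric_min :
  exists2 v : 'rV[R]_3, v != 0 & (v *m Ric T *m v^T) 0 0 = a + b.
Proof.
exists (row 2%:R P); last first.
  by rewrite Ric_form_frame frame_row !mxE /=; ring.
apply/eqP=> P0; have := frame_row 2%:R; rewrite P0 mul0mx.
by move=> /rowP/(_ 2%:R)/eqP; rewrite !mxE /= eq_sym oner_eq0.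
Qed.

End Frame.

(** * The ordered spectrum *)

Definition spread (R : realType) (a b c : R) : R :=
  Num.sqrt (a ^+ 2 + b ^+ 2 + c ^+ 2 - a * b - b * c - c * a).

(** The middle entries come from the off-diagonal directions, the extreme ones
    from the traceless diagonal matrices. *)
Definition curv2_spectrum (R : realType) (a b c : R) : seq R :=
  [:: (a + b + c) / 3 - 2 / 3 * spread a b c; a; b; c;
      (a + b + c) / 3 + 2 / 3 * spread a b c].

Lemma le_of_sqr (R : realDomainType) (x y : R) :
  0 <= y -> x ^+ 2 <= y ^+ 2 -> x <= y.
Proof. by move=> y0 xy; rewrite leNgt; apply/negP=> lt_yx; nra. Qed.

Section Spread.
Variables (R : realType) (a b c : R).

Lemma spread_ge0 : 0 <= spread a b c.
Proof. exact: sqrtr_ge0. Qed.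

Lemma sqr_spread :
  spread a b c ^+ 2 = a ^+ 2 + b ^+ 2 + c ^+ 2 - a * b - b * c - c * a.
Proof.
rewrite sqr_sqrtr //.
have := sqr_ge0 (a - b); have := sqr_ge0 (b - c); have := sqr_ge0 (c - a); nra.
Qed.

Hypotheses (le_ab : a <= b) (le_bc : b <= c).

(** With [p = b - a] and [q = c - a], the square of the spread is
    [p^2 - p q + q^2], and [0 <= p <= q]. *)
Lemma spread_le : spread a b c <= c - a.
Proof.
apply: le_of_sqr; rewrite ?sqr_spread; move: le_ab le_bc; nra.
Qed.

(** Four times the difference of the squares of the two sides is
    [3 (b - a)^2]. *)
Lemma spread_ge_top : c - (a + b) / 2 <= spread a b c.
Proof.
apply: le_of_sqr; rewrite ?spread_ge0 // sqr_spread.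
by have := sqr_ge0 (a - b); nra.
Qed.

(** Four times the difference of the squares of the two sides is
    [3 (c - b)^2]. *)
Lemma spread_ge_bottom : (b + c) / 2 - a <= spread a b c.
Proof.
apply: le_of_sqr; rewrite ?spread_ge0 // sqr_spread.
by have := sqr_ge0 (b - c); nra.
Qed.

Lemma sorted_curv2_spectrum : sorted <=%R (curv2_spectrum a b c).
Proof.
rewrite /= le_ab le_bc !andbT /=.
have := spread_ge_top; have := spread_ge_bottom => h1 h2.
by apply/andP; split; lra.
Qed.
End Spread.

Lemma char_poly_curv2_block (R : realType) (a b c : R) :
  char_poly (curv2_block a b c) = \prod_(x <- curv2_spectrum a b c) ('X - x%:P).
Proof.
rewrite /char_poly char_block_diag_mx det_ublock -!/(char_poly _).
rewrite char_poly_mx22 char_poly_trig; last exact/diag_mx_is_trig.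
rewrite !big_cons big_nil !big_ord_recl big_ord0 !mxE /=.
set m := _ - 2 / 3 * _; set n := _ + 2 / 3 * _.
set p := b + _; set q := a + _; set k := (_ * _ : R).
(* The 2 by 2 block has the same trace and determinant as the pair [m], [n]. *)
have sumE : p + q = m + n by rewrite /p /q /m /n; field.
have prodE : p * q - k = m * n.
  have := sqr_spread a b c; rewrite /p /q /k /m /n; lra.
have -> : p = m + n - q by rewrite -sumE addrK.
have -> : k = (m + n - q) * q - m * n by rewrite -prodE -sumE; ring.
rewrite !(polyCB, polyCD, polyCM); ring.
Qed.

Lemma ordered_eigenvalues_uniq (R : realType) (V : vectType R) (f : 'End(V))
    (s t : seq R) :
  ordered_eigenvalues f s -> ordered_eigenvalues f t -> s = t.
Proof.
move=> [s_sorted sE] [t_sorted tE].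
apply: (sorted_eq le_trans le_anti) => //.
by apply: prod_XsubC_eq; rewrite -sE -tE.
Qed.

Lemma partial_sum_nat (R : realType) (n : nat) (s : seq R) :
  partial_sum n%:R s = \sum_(i < n) s`_i.
Proof. by rewrite /partial_sum natrK subrr mul0r addr0. Qed.

Lemma partial_sum_three_and_third (R : realType) (s : seq R) :
  partial_sum (3 + 3^-1) s = s`_0 + s`_1 + s`_2 + s`_3 / 3.
Proof.
rewrite /partial_sum (_ : Num.truncn _ = 3%N); last first.
  by apply: truncn_def; apply/andP; split; lra.
rewrite !big_ord_recl big_ord0 /=.
by field.
Qed.

(** * Opposite tensors *)

Lemma curv2_opp (R : realType) (T : tensor4 R) :
  curv2 (fun i j k l => - T i j k l) = - curv2 T.
Proof.
apply/lfunP=> phi; rewrite opp_lfunE; apply: val_inj.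
rewrite [LHS]curv2E [RHS]linearN /= curv2E.
have -> : Rbar (fun i j k l => - T i j k l) (vsval phi) = - Rbar T (vsval phi).
  apply/matrixP=> i j; rewrite !mxE -sumrN; apply: eq_bigr => k _.
  by rewrite -sumrN; apply: eq_bigr => l _; rewrite mulNr.
apply/matrixP=> i j; rewrite /proj_S20 linearN /= [\tr (- _)]raddfN !mxE.
by case: (i == j); ring.
Qed.

Lemma algebraic_curvature_opp (R : realType) (T : tensor4 R) :
  algebraic_curvature T -> algebraic_curvature (fun i j k l => - T i j k l).
Proof.
case=> anti1 anti2 pair bianchi; split=> i j k l.
- by rewrite anti1.
- by rewrite anti2.
- by rewrite pair.
- by rewrite -!opprD bianchi oppr0.
Qed.

Lemma sec_opp (R : realType) (T : tensor4 R) (u v : 'rV[R]_3) :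
  sec (fun i j k l => - T i j k l) u v = - sec T u v.
Proof.
rewrite /sec -[RHS]mulNr /eval4; congr (_ / _).
do 4 (rewrite -sumrN; apply: eq_bigr => ? _).
by rewrite !mulNr.
Qed.

Lemma Ric_opp (R : realType) (T : tensor4 R) :
  Ric (fun i j k l => - T i j k l) = - Ric T.
Proof.
by apply/matrixP=> i k; rewrite !mxE -sumrN.
Qed.

Definition opp_sign (c : curv_sign) : curv_sign :=
  match c with
  | Nonnegative => Nonpositive
  | Positive => Negative
  | Negative => Positive
  | Nonpositive => Nonnegative
  end.

Lemma has_sign_opp (R : realType) (c : curv_sign) (x : R) :
  has_sign (opp_sign c) (- x) <-> has_sign c x.
Proof. by case: c; rewrite /= ?oppr_ge0 ?oppr_gt0 ?oppr_le0 ?oppr_lt0. Qed.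

(** * Comparison of sign conditions *)

Definition comparison (R : realType) (T : tensor4 R) (c : curv_sign) : Prop :=
  [/\ alpha_sign c 2 (curv2 T) -> sectional_sign c T,
      sectional_sign c T -> alpha_sign c (3 + 3^-1) (curv2 T),
      alpha_sign c (3 + 3^-1) (curv2 T) -> ricci_sign c T,
      ricci_sign c T -> alpha_sign c 4 (curv2 T) &
      scalar_sign c T <-> alpha_sign c 5 (curv2 T)].

(** Every curvature notion is odd in the tensor, and passing to the opposite
    tensor exchanges positive with negative and nonnegative with nonpositive.
    *)
Lemma comparison_opp (R : realType) (T : tensor4 R) (c : curv_sign) :
  comparison (fun i j k l => - T i j k l) (opp_sign c) -> comparison T c.
Proof.
have sec_iff :
    sectional_sign (opp_sign c) (fun i j k l => - T i j k l)
    <-> sectional_sign c T.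
  by split=> h u v uv; have := h u v uv; rewrite sec_opp has_sign_opp.
have Ric_iff :
    ricci_sign (opp_sign c) (fun i j k l => - T i j k l) <-> ricci_sign c T.
  by split=> h v vN0; have := h v vN0;
     rewrite Ric_opp mulmxN mulNmx [(- _ : 'M_1) 0 0]mxE has_sign_opp.
have scal_iff :
    scalar_sign (opp_sign c) (fun i j k l => - T i j k l) <-> scalar_sign c T.
  by rewrite /scalar_sign /scal Ric_opp [\tr (- _)]raddfN has_sign_opp.
have alpha_iff alpha :
    alpha_sign (opp_sign c) alpha (curv2 (fun i j k l => - T i j k l))
    <-> alpha_sign c alpha (curv2 T).
  rewrite curv2_opp; case: c {sec_iff Ric_iff scal_iff} => /=;
    by rewrite ?opprK.
by case=> h1 h2 h3 h4 h5; split;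
  rewrite -?alpha_iff -?sec_iff -?Ric_iff -?scal_iff.
Qed.

(** Each of the four sign conditions is the sign of an explicit expression in
    [x], [y], [z] and the spread: extremal planes and vectors are found in the
    frame, and the ordered spectrum is known. The implications are then
    linear. *)
Lemma comparison_nonnegative_positive (R : realType) (T : tensor4 R)
    (c : curv_sign) :
  algebraic_curvature T -> c = Nonnegative \/ c = Positive -> comparison T c.
Proof.
move=> hT cNP; have [P [x [y [z [PP RicD le_xy le_yz]]]]] := Ricci_frame hT.
have eig : ordered_eigenvalues (curv2 T) (curv2_spectrum x y z).
  split; first exact: sorted_curv2_spectrum.
  rewrite -char_poly_curv2_block.
  apply: (char_poly_mxof (framed_traceless_sym_inj PP)
                         (framed_traceless_sym_surj PP)) => v.
  exact: curv2_framed.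
have alpha_iff alpha :
    alpha_sign c alpha (curv2 T)
    <-> has_sign c (partial_sum alpha (curv2_spectrum x y z)).
  case: cNP => ->; split=> [[s sE]|sign]; try by exists (curv2_spectrum x y z).
    by rewrite (ordered_eigenvalues_uniq eig sE).
  by rewrite (ordered_eigenvalues_uniq eig sE).
have sec_iff : sectional_sign c T <-> has_sign c x.
  have [u [v [uv_free sec_uv]]] := sec_min hT PP RicD.
  split=> [/(_ u v uv_free)|x_sign p q pq_free]; first by rewrite sec_uv.
  have := le_sec hT PP RicD le_xy le_yz pq_free.
  by case: cNP x_sign => -> /=; lra.
have Ric_iff : ricci_sign c T <-> has_sign c (x + y).
  have [v vN0 Ric_v] := Ric_min PP RicD.
  split=> [/(_ v vN0)|xy_sign w wN0]; first by rewrite Ric_v.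
  have := le_Ric PP RicD le_xy le_yz w.
  have : 0 < dot w w by rewrite dotE row_self_product_gt0.
  by case: cNP xy_sign => -> /=; nra.
have scal_iff : scalar_sign c T <-> has_sign c (2 * (x + y + z)).
  by rewrite /scalar_sign (scal_frame PP RicD).
have r_le := spread_le le_xy le_yz.
have r_ge := spread_ge_top x y z.
have r_bot := spread_ge_bottom x y z.
split; rewrite alpha_iff ?sec_iff ?Ric_iff ?scal_iff;
  rewrite ?partial_sum_nat ?partial_sum_three_and_third;
  rewrite ?big_ord_recl ?big_ord0 /=;
  by case: cNP => -> /=; try split; lra.
Qed.

Unset Implicit Arguments.

Theorem proposition1p2 (R : realType) (T : tensor4 R)
    (hT : algebraic_curvature T) (c : curv_sign) :
  [/\ alpha_sign c 2 (curv2 T) -> sectional_sign c T,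
      sectional_sign c T -> alpha_sign c (3 + 3^-1) (curv2 T),
      alpha_sign c (3 + 3^-1) (curv2 T) -> ricci_sign c T,
      ricci_sign c T -> alpha_sign c 4 (curv2 T) &
      scalar_sign c T <-> alpha_sign c 5 (curv2 T)].
Proof.
have hNT := algebraic_curvature_opp hT.
case: c.
- by apply: comparison_nonnegative_positive => //; left.
- by apply: comparison_nonnegative_positive => //; right.
- by apply: comparison_opp; apply: comparison_nonnegative_positive => //; right.
- by apply: comparison_opp; apply: comparison_nonnegative_positive => //; left.
Qed.
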